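(* Let $S$ be the Sorgenfrey line, let $n\in\mathbb{N}$, and let $\mathcal{I}$ be the ideal of sets $I\subset S^{n}$ such that $I\subset[-k,k]^{n}$ for some $k\in\mathbb{N}$. Then the Banach space $CB_{0}(S^{n},\mathcal{I})$ is uniformly convex-transitive.
   Context: All Banach spaces are real. The Sorgenfrey line $S$ is the set $\mathbb{R}$ with the topology generated by the half-open intervals $[a,b)$; $S^n$ carries the product topology. For a topological space $T$, $CB(T)$ is the Banach space of continuous bounded functions $T\to\mathbb{R}$ with the sup norm. For an ideal $\mathcal{I}$ of subsets of $T$, $CB_{0}(T,\mathcal{I})\subset CB(T)$ is the closed subspace of those $f$ with $\lim_{t,\mathcal{I}}|f(t)|=0$, i.e. $\{t\in T:\ |f(t)|\geq\epsilon\}\in\mathcal{I}$ for every $\epsilon>0$. For a Banach space $X$, $\mathbf{S}_X$ is its unit sphere and $\mathcal{G}_X$ is the group of isometric (linear, surjective) automorphisms of $X$. For $x\in\mathbf{S}_X$ and $n\in\mathbb{N}$ put $C_n(x)=\{\sum_{i=1}^{n}a_iT_i(x):\ T_1,\dots,T_n\in\mathcal{G}_X,\ a_1,\dots,a_n\in[0,1],\ \sum_{i=1}^n a_i=1\}$. $X$ is uniformly convex-transitive if for each $\varepsilon>0$ there is $n\in\mathbb{N}$ such that $\mathrm{dist}(y,C_n(x))\leq\varepsilon$ for all $x,y\in\mathbf{S}_X$. *)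

(* Defs.v *)
From HB Require Import structures.
From mathcomp Require Import all_boot all_order all_algebra.
From mathcomp Require Import mathcomp_extra boolp classical_sets functions.
From mathcomp Require Import interval_inference reals constructive_ereal ereal.
From mathcomp Require Import topology normedtype.
From mathcomp Require Import ring.

Set Implicit Arguments.
Unset Strict Implicit.
Unset Printing Implicit Defensive.

Import Order.TTheory GRing.Theory Num.Theory.
Import numFieldNormedType.Exports.

Local Open Scope classical_set_scope.
Local Open Scope ring_scope.

(* A type alias of R, so that it does not inherit the usual topology of R. *)
Definition sorgenfrey (R : realType) : Type := R.

HB.instance Definition _ (R : realType) :=
  Pointed.copy (sorgenfrey R) R.

Section sorgenfrey_topology.
Variable R : realType.

Definition half_open (ab : R * R) : set (sorgenfrey R) :=
  [set x : R | ab.1 <= x < ab.2].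

Lemma half_open_cover : \bigcup_(ab in setT) half_open ab = setT.
Proof.
apply/seteqP; split => // x _; exists ((x : R), (x : R) + 1) => //=.
by rewrite /half_open /= lexx ltrDl ltr01.
Qed.

Lemma half_open_join (ab cd : R * R) (x : sorgenfrey R) : setT ab -> setT cd ->
  half_open ab x -> half_open cd x ->
  exists ef, [/\ setT ef, half_open ef x &
                 half_open ef `<=` half_open ab `&` half_open cd].
Proof.
move=> _ _ /andP[ax xb] /andP[cx xd].
exists (Num.max ab.1 cd.1, Num.min ab.2 cd.2); split => //.
  by rewrite /half_open /= ge_max lt_min ax cx xb xd.
move=> y; rewrite /half_open /= ge_max lt_min.
by move=> /andP[/andP[-> ->] /andP[-> ->]].
Qed.

HB.instance Definition _ := isBaseTopological.Build (sorgenfrey R)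
  half_open_cover half_open_join.

End sorgenfrey_topology.

Section bounded_continuous_functions.
Variables (R : realType) (T : topologicalType).

Definition cb : {pred T -> R} :=
  [pred f | `[< continuous f /\ [bounded f t | t in setT] >]].

Record CB := MkCB { CB_fun :> T -> R; CB_funP : CB_fun \in cb }.

HB.instance Definition _ := [isSub for CB_fun].
HB.instance Definition _ := [Choice of CB by <:].

Lemma cbP (f : T -> R) : reflect
  (continuous f /\ exists M : R, forall t, `|f t| <= M) (f \in cb).
Proof.
apply: (iffP (asboolP _)) => -[cf bf]; split => //.
  by have [M _ fM] := pinfty_ex_gt0 bf; exists M => t; exact: fM.
have [M fM] := bf; rewrite /bounded_near; near=> N => t _ /=.
apply: (le_trans (fM t)); near: N; apply: nbhs_pinfty_ge; exact: num_real.
Unshelve. all: by end_near. Qed.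

Lemma cb_submod_closed : submod_closed cb.
Proof.
split.
  by apply/cbP; split; [exact: cst_continuous|exists 0 => t; rewrite normr0].
move=> a f g /cbP[cf [M fM]] /cbP[cg [N gN]]; apply/cbP; split.
  by move=> t; apply: cvgD; [apply: cvgZr; exact: cf|exact: cg].
exists (`|a| * M + N) => t; apply: le_trans (ler_normD _ _) _.
by rewrite lerD ?normrM ?ler_wpM2l ?fM ?gN.
Qed.

HB.instance Definition _ := GRing.isSubmodClosed.Build _ _ cb cb_submod_closed.
HB.instance Definition _ := [SubChoice_isSubLmodule of CB by <:].

Lemma CB_ext (f g : CB) : (forall t, f t = g t) -> f = g.
Proof. by move=> fg; apply/val_inj/funext. Qed.

Lemma CB_continuous (f : CB) : continuous (f : T -> R).
Proof. by have /cbP[] := CB_funP f. Qed.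

Definition sup_norm (f : CB) : R := sup [set `|f t| | t in setT].

Lemma le_sup_norm (f : CB) t : `|f t| <= sup_norm f.
Proof.
have /cbP[_ [M fM]] := CB_funP f.
by apply: ub_le_sup; [exists M => _ [s _ <-]|exists t].
Qed.

Lemma sup_norm_le (f : CB) M :
  0 <= M -> (forall t, `|f t| <= M) -> sup_norm f <= M.
Proof.
move=> M0 fM; have [[t _]|T0] := pselect ([set: T] !=set0).
  by apply: ge_sup => [|_ [s _ <-]//]; exists `|f t|; exists t.
rewrite /sup_norm; have -> : [set `|f t| | t in setT] = set0.
  by apply/seteqP; split => // z [s _ _]; apply: T0; exists s.
by rewrite sup0.
Qed.

Lemma sup_norm_ge0 (f : CB) : 0 <= sup_norm f.
Proof.
have [[t _]|T0] := pselect ([set: T] !=set0).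
  exact: le_trans (normr_ge0 (f t)) (le_sup_norm f t).
rewrite /sup_norm; have -> : [set `|f t| | t in setT] = set0.
  by apply/seteqP; split => // z [s _ _]; apply: T0; exists s.
by rewrite sup0.
Qed.

Lemma sup_normD (f g : CB) : sup_norm (f + g) <= sup_norm f + sup_norm g.
Proof.
apply: sup_norm_le => [|t]; first by rewrite addr_ge0 ?sup_norm_ge0.
by apply: le_trans (ler_normD _ _) _; rewrite lerD ?le_sup_norm.
Qed.

Lemma sup_normZ (a : R) (f : CB) : sup_norm (a *: f) = `|a| * sup_norm f.
Proof.
have le b (g : CB) : sup_norm (b *: g) <= `|b| * sup_norm g.
  apply: sup_norm_le => [|t]; first by rewrite mulr_ge0 ?sup_norm_ge0.
  by rewrite [X in `|X|](_ : _ = b * g t) // normrM ler_wpM2l ?le_sup_norm.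
apply/eqP; rewrite eq_le le /=; have [->|a0] := eqVneq a 0.
  by rewrite normr0 mul0r sup_norm_ge0.
rewrite -ler_pdivlMl ?normr_gt0 // -normfV.
by have := le a^-1 (a *: f); rewrite scalerA mulVf // scale1r.
Qed.

Lemma sup_norm0_eq0 (f : CB) : sup_norm f = 0 -> f = 0.
Proof.
move=> f0; apply: CB_ext => t; apply/eqP; change (f t == 0).
by rewrite -normr_le0 -f0 le_sup_norm.
Qed.

HB.instance Definition _ :=
  Lmodule_isNormed.Build R CB sup_normD sup_normZ sup_norm0_eq0.

Lemma CB_complete (F : set_system CB) : ProperFilter F -> cauchy F -> cvg F.
Proof.
move=> FF /cauchy_ballP cF.
have Fnear (e : R) : 0 < e ->
    F [set g : CB | F [set h : CB | forall t, `|g t - h t| < e] ].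
  move=> e0; have := cF _ e0; rewrite near_map2 => -[[A B] /= [FA FB] AB].
  apply: filterS FA => g Ag; apply: filterS FB => h Bh t.
  have := AB (g, h) (conj Ag Bh); rewrite /= -ball_normE /=.
  exact: le_lt_trans (le_sup_norm (g - h) t).
pose f t : R := lim (g t @[g --> F]).
have Ff t : g t @[g --> F] --> f t.
  apply: cauchy_cvg; apply: cauchy_exP => e e0.
  have [g Fg] := filter_ex (Fnear _ e0); exists (g t).
  suff : F [set h : CB | ball (g t) e (h t)] by [].
  by apply: filterS Fg => h Fgh; rewrite -ball_normE; exact: Fgh.
have Funif (e : R) : 0 < e -> F [set g : CB | forall t, `|f t - g t| <= e].
  move=> e0; apply: filterS (Fnear _ e0) => g Fg t.
  apply/ler_addgt0Pl => d d0.
  have Fd : F [set h : CB | `|f t - h t| <= d].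
    by have /cvgrPdist_le /(_ _ d0) := Ff t.
  have [h [/= fh gh]] := filter_ex (filterI Fd Fg).
  rewrite (_ : f t - g t = (f t - h t) + (h t - g t)); last first.
    by ring.
  by apply: le_trans (ler_normD _ _) _; rewrite lerD // distrC ltW.
have cbf : f \in cb.
  apply/cbP; split.
    move=> t; apply/cvgrPdist_le => e e0.
    have e3 : 0 < e / 3 by rewrite divr_gt0.
    have [g fg] := filter_ex (Funif _ e3).
    have /cvgrPdist_le /(_ _ e3) := @CB_continuous g t.
    apply: filterS => s gts.
    rewrite (_ : f t - f s = (f t - g t) + (g t - g s) + (g s - f s)); last first.
      by ring.
    apply: le_trans (ler_normD _ _) _.
    rewrite (_ : e = e / 3 + e / 3 + e / 3); last by field.
    apply: lerD; last by rewrite distrC.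
    by apply: le_trans (ler_normD _ _) _; apply: lerD.
  have [g fg] := filter_ex (Funif _ ltr01).
  exists (1 + `|g| ) => t; rewrite -(subrK (g t) (f t)).
  by apply: le_trans (ler_normD _ _) _; rewrite lerD // le_sup_norm.
apply/cvg_ex; exists (MkCB cbf); apply/cvgrPdist_le => e e0.
by apply: filterS (Funif _ e0) => g fg; apply: sup_norm_le => //; exact: ltW.
Qed.

HB.instance Definition _ := Uniform_isComplete.Build CB CB_complete.

End bounded_continuous_functions.

Record set_ideal (T : Type) := SetIdeal {
  ideal_mem :> set T -> Prop;
  ideal_set0 : ideal_mem set0;
  ideal_sub : forall A B, A `<=` B -> ideal_mem B -> ideal_mem A;
  ideal_setU : forall A B, ideal_mem A -> ideal_mem B -> ideal_mem (A `|` B) }.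

Section vanishing_along_ideal.
Variables (R : realType) (T : topologicalType) (I : set_ideal T).

Definition cb0 : {pred CB R T} :=
  [pred f : CB R T |
    `[< forall e : R, 0 < e -> I [set t | e <= `|f t| ] >]].

Record CB0 := MkCB0 { CB0_val :> CB R T; CB0_valP : CB0_val \in cb0 }.

HB.instance Definition _ := [isSub for CB0_val].
HB.instance Definition _ := [Choice of CB0 by <:].

Lemma cb0P (f : CB R T) : reflect
  (forall e : R, 0 < e -> I [set t | e <= `|f t| ]) (f \in cb0).
Proof. exact: asboolP. Qed.

Lemma cb0_submod_closed : submod_closed cb0.
Proof.
split.
  apply/cb0P => e e0; apply: ideal_sub (ideal_set0 I) => t /=.
  by rewrite normr0 leNgt e0.
move=> a f g /cb0P If /cb0P Ig; apply/cb0P => e e0.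
have a0 : 0 < `|a| + 1 by rewrite ltr_wpDl.
have ea : 0 < e / 2 / (`|a| + 1) by rewrite !divr_gt0.
have e2 : 0 < e / 2 by rewrite divr_gt0.
apply: ideal_sub (ideal_setU (If _ ea) (Ig _ e2)) => t /= et.
apply: contrapT => /not_orP[/negP]; rewrite -ltNge => ft.
move/negP; rewrite -ltNge => gt.
move: et; apply/negP; rewrite -ltNge; apply: le_lt_trans (ler_normD _ _) _.
rewrite [e in ltRHS]splitr ltr_leD //; last exact: ltW.
rewrite [X in `|X|](_ : _ = a * f t) // normrM.
move: ft; rewrite ltr_pdivlMr // mulrDr mulr1 mulrC.
by apply: le_lt_trans; rewrite lerDl.
Qed.

HB.instance Definition _ :=
  GRing.isSubmodClosed.Build _ _ cb0 cb0_submod_closed.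
HB.instance Definition _ := [SubChoice_isSubLmodule of CB0 by <:].

Definition CB0_norm (f : CB0) : R := `|CB0_val f|.

Lemma CB0_normD (f g : CB0) : CB0_norm (f + g) <= CB0_norm f + CB0_norm g.
Proof. exact: ler_normD. Qed.

Lemma CB0_normZ (a : R) (f : CB0) : CB0_norm (a *: f) = `|a| * CB0_norm f.
Proof. exact: normrZ. Qed.

Lemma CB0_norm0_eq0 (f : CB0) : CB0_norm f = 0 -> f = 0.
Proof. by move=> /eqP; rewrite normr_eq0 => /eqP f0; apply: val_inj. Qed.

HB.instance Definition _ :=
  Lmodule_isNormed.Build R CB0 CB0_normD CB0_normZ CB0_norm0_eq0.

Lemma CB0_complete (F : set_system CB0) : ProperFilter F -> cauchy F -> cvg F.
Proof.
move=> FF /cauchy_ballP cF.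
have cG : cauchy (CB0_val @ F).
  apply/cauchy_ballP => e e0; rewrite near_map2.
  have := cF _ e0; rewrite !near_map2 => -[[A B] /= [FA FB] AB].
  by exists (A, B).
have /cvg_ex[/= f Gf] : cvg (CB0_val @ F) by exact: cauchy_cvg.
have cb0f : f \in cb0.
  apply/cb0P => e e0; have e2 : 0 < e / 2 by rewrite divr_gt0.
  have /cvgrPdist_lt /(_ _ e2) /filter_ex[g fg] := Gf.
  have /cb0P Ig := CB0_valP g.
  apply: ideal_sub (Ig _ e2) => t /= et.
  have := le_trans (le_sup_norm (f - CB0_val g) t) (ltW fg).
  move=> /(le_trans (lerB_dist _ _)).
  by rewrite lerBlDr -lerBlDl; apply: le_trans; rewrite lerBrDr -splitr.
apply/cvg_ex; exists (MkCB0 cb0f); apply/cvgrPdist_lt => e e0.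
by have /cvgrPdist_lt /(_ _ e0) := Gf.
Qed.

HB.instance Definition _ := Uniform_isComplete.Build CB0 CB0_complete.

End vanishing_along_ideal.

Section convex_transitivity.
Variables (R : realType) (X : completeNormedModType R).

Definition unit_sphere : set X := [set x | `|x| = 1].

Definition isometric_automorphism (T : {linear X -> X}) : Prop :=
  (forall x, `|T x| = `|x|) /\ set_surj setT setT T.

Definition C_ (n : nat) (x : X) : set X :=
  [set z | exists (T : 'I_n -> {linear X -> X}) (a : 'I_n -> R),
    [/\ forall i, isometric_automorphism (T i),
        forall i, 0 <= a i <= 1,
        \sum_(i < n) a i = 1 &
        z = \sum_(i < n) a i *: T i x] ].

Lemma edist_norm (x y : X) : edist (x, y) = `|x - y|%:E.
Proof.
apply/eqP; rewrite eq_le; apply/andP; split.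
  apply/lee_addgt0Pr => e e0; rewrite -EFinD; apply: edist_fin.
    by rewrite ltr_wpDl.
  by rewrite -ball_normE /= ltrDl.
apply: le_ereal_inf_tmp => _ [r [_ xyr] <-].
by move: xyr; rewrite -ball_normE lee_fin => /ltW.
Qed.

(* [edist_inf] is the distance to a set as an extended real: it is +oo on the
   empty set C_ 0 x. *)
Definition uniformly_convex_transitive : Prop :=
  forall e : R, 0 < e -> exists n : nat, forall x y,
    unit_sphere x -> unit_sphere y -> (edist_inf (C_ n x) y <= e%:E)%E.

End convex_transitivity.

Arguments uniformly_convex_transitive {R} X.

Section box_ideal.
Variables (R : realType) (n : nat).

Definition sorgenfrey_pow := {ptws 'I_n -> sorgenfrey R}.

Definition in_box (A : set sorgenfrey_pow) : Prop :=
  exists k : nat, A `<=` [set x | forall i, - k%:R <= (x i : R) <= k%:R].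

Lemma in_box0 : in_box set0. Proof. by exists 0%N. Qed.

Lemma in_boxS A B : A `<=` B -> in_box B -> in_box A.
Proof. by move=> AB [k Bk]; exists k => x /AB /Bk. Qed.

Lemma in_boxU A B : in_box A -> in_box B -> in_box (A `|` B).
Proof.
move=> [k Ak] [l Bl]; exists (maxn k l) => x [/Ak|/Bl] /= xb i;
  have /andP[h1 h2] := xb i; apply/andP; split.
- by apply: le_trans h1; rewrite lerN2 ler_nat leq_maxl.
- by apply: le_trans h2 _; rewrite ler_nat leq_maxl.
- by apply: le_trans h1; rewrite lerN2 ler_nat leq_maxr.
- by apply: le_trans h2 _; rewrite ler_nat leq_maxr.
Qed.

Definition box_ideal : set_ideal sorgenfrey_pow :=
  SetIdeal in_box0 in_boxS in_boxU.

End box_ideal.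

(* Main.v *)
(* Let [x], [y] be unit vectors, and [d > 0] small.  Up to sign, [x] is within
   [d] of 1 on a half-open box, and [|y| < d] outside a box, which an increasing
   affine map [phi] sends into the former one.  The isometries
   [f |-> sg * (f \o phi)], with [sg] continuous and [{-1, 1}]-valued, suffice:
   where [|y| >= d], the average of the [sg * (x \o phi)] is close to that of
   the [sg], and elsewhere it is small as soon as the average of the [sg] is.  It
   remains to write [y] approximately as an average of a number [N = N(d)] of
   such [sg], which is easy if [y] is locally constant.
   The heart of the matter is thus to approximate [y] uniformly by locally
   constant functions although [S^n] is not Lindelof.  Call [t] tame at scale
   [1/m] if [y] varies by at most [d] on [t + [0, 1/m)^n].  In a cube of the grid
   of mesh [1/m], the points lying above some tame point form an upper set, on
   which [y] varies little because two tame points have a common upper bound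
   in both of their corners; and the closure of an upper set is clopen, because
   it is again an upper set, and upper sets are open. *)
From HB Require Import structures.
Require Import Defs.
From mathcomp Require Import all_boot all_order all_algebra.
From mathcomp Require Import boolp classical_sets filter.
From mathcomp Require Import constructive_ereal ereal.
From mathcomp Require Import reals topology normedtype.
From mathcomp Require Import ring lra.

Set Implicit Arguments.
Unset Strict Implicit.
Unset Printing Implicit Defensive.

Import Order.TTheory GRing.Theory Num.Theory.
Import numFieldNormedType.Exports.

Local Open Scope classical_set_scope.
Local Open Scope ring_scope.

(** * Neighbourhoods in the Sorgenfrey line and its powers *)

Lemma nbhs_sorgenfrey (R : realType) (x : sorgenfrey R)
    (A : set (sorgenfrey R)) :
  nbhs x A <-> exists2 d : R, 0 < d & half_open (x : R, (x : R) + d) `<=` A.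
Proof.
split=> [|[d d0 dA]].
  rewrite nbhsE => -[U [[D _ <-] [[a b] Dab /andP[/= ax xb]]] UA].
  exists ((b : R) - x); first by rewrite subr_gt0.
  move=> y /andP[/= xy yd]; apply: UA; exists (a, b) => //.
  by rewrite /half_open /= (le_trans ax xy); move: yd; rewrite addrC subrK.
rewrite nbhsE; exists (half_open (x : R, (x : R) + d)) => //; split.
  by exists [set (x : R, (x : R) + d)] => //; rewrite bigcup_set1.
by rewrite /half_open /= lexx ltrDl.
Qed.

Section powers.
Variables (R : realType) (n : nat).
Local Notation P := (sorgenfrey_pow R n).
Implicit Types (s t x : P) (d : R).

Definition corner t d : set P :=
  [set s | forall i, (t i : R) <= s i < (t i : R) + d].

Lemma corner_le t d d' : d <= d' -> corner t d `<=` corner t d'.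
Proof.
by move=> dd s ts i; have /andP[-> /lt_le_trans->] := ts i; rewrite ?lerD2l.
Qed.

(** Corners are neighbourhoods because ['I_n] is finite; conversely, they converge to [t] in each
    coordinate, hence in the product topology. *)
Lemma nbhs_corner t (A : set P) :
  nbhs t A <-> exists2 d, 0 < d & corner t d `<=` A.
Proof.
split=> [|[d d0 dA]]; last first.
  suff : nbhs t (corner t d) by apply: filterS.
  pose B i : set P := [set s | (t i : R) <= s i < (t i : R) + d].
  suff : \forall s \near t, forall i, B i s by [].
  apply: (@filter_forall _ _ _ (nbhs t) _) => i.
  apply: (@proj_continuous 'I_n (fun=> sorgenfrey R) i t
    (half_open (t i : R, (t i : R) + d))).
  by apply/nbhs_sorgenfrey; exists d.
pose F := filter_from [set d : R | 0 < d] (corner t).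
have FF : Filter F.
  apply: filter_from_filter; first by exists 1; exact: ltr01.
  move=> d d' d0 d'0; exists (Num.min d d'); first by rewrite /= lt_min d0.
  by move=> s ts; split; apply: corner_le ts; rewrite ge_min lexx ?orbT.
suff Ft : F --> t by move=> /Ft[d]; exists d.
apply/cvg_sup => i B; rewrite nbhsE => -[_ [[U oU <-] Ut] UB].
have /nbhs_sorgenfrey[d d0 dU] : nbhs (t i) U by exact: open_nbhs_nbhs.
by exists d => // s /(_ i) tsi; apply/UB/dU.
Qed.

Definition cube (m : nat) t : {ffun 'I_n -> int} :=
  [ffun i => Num.floor ((t i : R) * m.+1%:R)].

Lemma cube_lt m s t i : cube m s = cube m t ->
  (s i : R) < (t i : R) + m.+1%:R^-1.
Proof.
move=> /ffunP /(_ i); rewrite !ffunE => st.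
have m0 : (0 : R) < m.+1%:R by rewrite ltr0n.
rewrite -(ltr_pM2r m0) mulrDl mulVf ?gt_eqF //.
have := floorD1_gt ((s i : R) * m.+1%:R); rewrite st intrD => /lt_le_trans->//.
by rewrite lerD2r floor_le.
Qed.

Lemma near_cube m t : \forall s \near t, cube m s = cube m t.
Proof.
have m0 : (0 : R) < m.+1%:R by rewrite ltr0n.
pose B i : set P := [set s | cube m s i = cube m t i].
suff : \forall s \near t, forall i, B i s.
  by apply: filterS => s st; apply/ffunP.
apply: (@filter_forall _ _ B (nbhs t) _) => i; apply/nbhs_corner.
(* The gap from [t i] up to the next grid point. *)
exists (((cube m t i)%:~R + 1) / m.+1%:R - (t i : R)).
  by rewrite ffunE subr_gt0 ltr_pdivlMr // -(intrD _ _ 1) floorD1_gt.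
move=> s /(_ i); rewrite /B /= !ffunE addrC subrK ltr_pdivlMr //.
move=> /andP[ts st].
apply: floor_def; rewrite intrD st andbT.
by apply: le_trans (floor_le _) _; rewrite ler_pM2r.
Qed.

Definition sup_pt s t : P := fun i => Num.max (s i : R) (t i : R).

(** * Clopen sets generated by tame points *)

Section oscillation.
Variables (f : P -> R) (e : R).
Hypotheses (cf : continuous f) (e0 : 0 < e).

Definition tame (m : nat) : set P :=
  [set t | forall s, corner t m.+1%:R^-1 s -> `|f s - f t| <= e].

(** Closure of the upper set generated by the tame points of the cube of [x]: [corner x d] meets it
    iff it contains [sup_pt x t] for some such [t]. *)
Definition tame_closure (m : nat) : set P := [set x | forall d, 0 < d ->
  exists t, [/\ tame m t, cube m t = cube m x &
                forall i, (t i : R) < (x i : R) + d] ].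

Lemma tame_closure_cover x : exists m, tame_closure m x.
Proof.
have /cvgrPdist_le /(_ _ e0) /nbhs_corner[d d0 dP] := @cf x.
(* For this [m], [1 / (m + 1) <= d], so [x] itself is tame. *)
exists (Num.truncn d^-1) => d' d'0.
exists x; split => // [s xs|i]; last by rewrite ltrDl.
rewrite distrC; apply: dP; apply: corner_le xs.
by rewrite invf_ple ?posrE ?ltr0n //; apply/ltW/truncnS_gt.
Qed.

(** Membership passes to the points of the cube above [x]. If [d] witnesses non-membership of [x],
    then [d / 2] does so for the points of the cube in [corner x (d / 2)]. *)
Lemma near_tame_closure m x :
  \forall y \near x, tame_closure m y <-> tame_closure m x.
Proof.
have ncube := near_cube m x.
have [Cx|nCx] := pselect (tame_closure m x).
  have xy : nbhs x (corner x 1) by apply/nbhs_corner; exists 1.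
  apply: filterS2 ncube xy => y cy xy; split => // _ d d0.
  have [t [At tx lt_t]] := Cx d d0.
  exists t; split => // [|i]; first by rewrite cy.
  apply: lt_le_trans (lt_t i) _; rewrite lerD2r.
  by have /andP[] := xy i.
have [d d0 dP] : exists2 d, 0 < d & forall t, tame m t -> cube m t = cube m x ->
    ~ forall i, (t i : R) < (x i : R) + d.
  apply: contrapT => H; apply: nCx => d d0; apply: contrapT => K.
  by apply: H; exists d => // t At tx xt; apply: K; exists t.
have d2 : 0 < d / 2 by rewrite divr_gt0.
have xy : nbhs x (corner x (d / 2)) by apply/nbhs_corner; exists (d / 2).
apply: filterS2 ncube xy => y cy xy; split => // Cy; exfalso.
have [t [At ty lt_t]] := Cy _ d2.
apply: (dP t) => // [|i]; first by rewrite ty.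
have /andP[_ yx] := xy i; have := lt_t i; lra.
Qed.

(* Two points of one cube have their join in the corner of both, so that [f]
   nearly agrees at all the tame points of a cube. *)
Lemma tame_closure_osc m x y :
  tame_closure m x -> tame_closure m y -> cube m x = cube m y ->
  `|f x - f y| <= 6 * e.
Proof.
have join s t : cube m s = cube m t -> corner s m.+1%:R^-1 (sup_pt s t).
  move=> st i; rewrite /sup_pt le_max lexx gt_max (cube_lt _ (esym st)) andbT.
  by rewrite ltrDl invr_gt0 ltr0n.
have joinC s t : sup_pt s t = sup_pt t s.
  by apply/funext => i; rewrite /sup_pt maxC.
(* [sup_pt z t] is close to [z] and in the corner of the tame point [t]: one [e] for each. *)
have close z : tame_closure m z ->
    exists t, [/\ tame m t, cube m t = cube m z & `|f z - f t| <= 2 * e].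
  move=> Cz; have /cvgrPdist_le /(_ _ e0) /nbhs_corner[d d0 dP] := @cf z.
  have [t [At tz lt_t]] := Cz d d0; exists t; split => //.
  have zw : `|f z - f (sup_pt z t)| <= e.
    apply: dP => i; rewrite /sup_pt le_max lexx gt_max lt_t andbT.
    by rewrite ltrDl.
  have tw : `|f (sup_pt z t) - f t| <= e.
    by apply: At; rewrite joinC; apply: join.
  by move: zw tw; rewrite !ler_norml => /andP[? ?] /andP[? ?]; lra.
move=> /close[t [At tx xt]] /close[u [Au uy yu]] xy.
have tu : cube m t = cube m u by rewrite tx uy.
have tw := At _ (join _ _ tu); have uw := Au _ (join _ _ (esym tu)).
move: xt yu tw uw; rewrite (joinC u) !ler_norml.
by move=> /andP[? ?] /andP[? ?] /andP[? ?] /andP[? ?]; lra.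
Qed.

End oscillation.

(* That is, powers of the Sorgenfrey line are strongly zero-dimensional. *)
Lemma clopen_partition (f : P -> R) (e : R) : continuous f -> 0 < e ->
  exists (K : Type) (k : P -> K), (forall x, \forall y \near x, k y = k x) /\
    (forall x y, k x = k y -> `|f x - f y| <= e).
Proof.
move=> cf e0; have e6 : 0 < e / 6 by rewrite divr_gt0.
pose C := tame_closure f (e / 6).
have exC x : exists m, `[< C m x >].
  by have [m Cm] := tame_closure_cover cf e6 x; exists m; apply/asboolP.
pose m x := ex_minn (exC x).
have Cm x : C (m x) x by rewrite /m; case: ex_minnP => k /asboolP.
have min_m x k : C k x -> (m x <= k)%N.
  by rewrite /m; case: ex_minnP => j _ jmin Ck; apply: jmin; apply/asboolP.
(* The label of [x]: the least scale that admits [x], and the cube at this scale. *)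
exists (nat * {ffun 'I_n -> int})%type, (fun x => (m x, cube (m x) x)); split.
  move=> x.
  (* Finitely many clopen conditions, for [k <= m x], decide whether [m y = m x]. *)
  pose B (k : 'I_(m x).+1) : set P := [set y | C k y <-> C k x].
  have nC : \forall y \near x, forall k, B k y.
    apply: (@filter_forall _ _ B (nbhs x) _) => k.
    exact: near_tame_closure.
  apply: filterS2 nC (near_cube (m x) x) => y nC cy.
  suff -> : m y = m x by rewrite cy.
  have {}nC k : (k <= m x)%N -> (C k y <-> C k x).
    by move=> kx; exact: (nC (Ordinal (kx : k < (m x).+1)%N)).
  have yx : (m y <= m x)%N by apply: min_m; apply/nC => //; exact: Cm.
  by apply/eqP; rewrite eqn_leq yx /=; apply/min_m/nC => //; exact: Cm.
move=> x y [mxy]; rewrite mxy => cxy.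
rewrite (_ : e = 6 * (e / 6)); last by field.
apply: (@tame_closure_osc f _ cf e6 (m y)) => //; last exact: Cm.
by rewrite -mxy; exact: Cm.
Qed.

End powers.

(** * Isometries by composition and change of sign *)

Section automorphisms.
Variables (R : realType) (T : topologicalType) (I : set_ideal T).

Lemma weighted_composition (phi psi : T -> T) (sg : T -> R) :
    cancel phi psi -> cancel psi phi -> continuous phi -> continuous psi ->
    (forall A, I A -> I (phi @^-1` A)) -> (forall A, I A -> I (psi @^-1` A)) ->
    continuous sg -> (forall t, `|sg t| = 1) ->
  exists2 L : {linear CB0 R I -> CB0 R I}, isometric_automorphism L &
    forall f t, L f t = sg t * f (phi t).
Proof.
have cb0W (h : T -> T) (w : T -> R) : continuous h ->
    (forall A, I A -> I (h @^-1` A)) ->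
    continuous w -> (forall t, `|w t| = 1) -> forall f : CB0 R I,
    exists g : CB0 R I, forall t, g t = w t * f (h t).
  move=> ch Ih cw w1 f; have /cbP[cf [M fM]] := CB_funP f.
  have cbg : (fun t => w t * f (h t)) \in @cb R T.
    apply/cbP; split; last by exists M => t; rewrite normrM w1 mul1r.
    move=> t; apply: cvgM; first exact: cw.
    by apply: continuous_comp; [exact: ch|exact: cf].
  have cb0g : MkCB cbg \in @cb0 R T I.
    apply/cb0P => e e0; have /cb0P /(_ e e0) /Ih := CB0_valP f.
    by apply: ideal_sub => t /=; rewrite normrM w1 mul1r.
  by exists (MkCB0 cb0g).
move=> phiK psiK cphi cpsi Iphi Ipsi csg sg1.
have W := cb0W _ _ cphi Iphi csg sg1.
pose L f := sval (cid (W f)).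
have LE f t : L f t = sg t * f (phi t) by rewrite /L; case: cid.
have CB0_ext (f g : CB0 R I) : (forall t, f t = g t) -> f = g.
  by move=> fg; apply/val_inj/CB_ext.
have linL : linear L.
  move=> a f g; apply: CB0_ext => t.
  rewrite LE [RHS](_ : _ = a * L f t + L g t) // !LE.
  rewrite [X in _ * X](_ : _ = a * f (phi t) + g (phi t)) //.
  by ring.
pose lin := GRing.isLinear.Build _ _ _ _ L linL.
pose LL : {linear CB0 R I -> CB0 R I} := HB.pack L lin.
exists LL; last exact: LE.
split=> [f|g _]; last first.
  have csgpsi : continuous (sg \o psi).
    by move=> t; apply: continuous_comp; [exact: cpsi|exact: csg].
  (* As [sg] squares to 1, [(sg \o psi) * (g \o psi)] is a preimage of [g]. *)
  have [f fE] := cb0W _ _ cpsi Ipsi csgpsi (fun t => sg1 (psi t)) g.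
  exists f => //; apply: CB0_ext => t; rewrite LE fE /= phiK mulrA.
  by rewrite -expr2 -[_ ^+ 2]real_normK ?num_real // sg1 expr1n mul1r.
apply/eqP; rewrite eq_le; apply/andP; split; apply: sup_norm_le => [|t].
- exact: sup_norm_ge0.
- by rewrite LE normrM sg1 mul1r le_sup_norm.
- exact: sup_norm_ge0.
- by rewrite -[t]psiK -[leLHS]mul1r -(sg1 (psi t)) -normrM -LE le_sup_norm.
Qed.

End automorphisms.

Lemma edist_inf_le (R : realType) (X : completeNormedModType R) (A : set X)
    (y z : X) (e : R) : A z -> `|y - z| <= e -> (edist_inf A y <= e%:E)%E.
Proof.
move=> Az yz; apply: (@le_trans _ _ (edist (y, z))).
  by apply: ereal_inf_lbound; exists z.
by rewrite edist_norm lee_fin.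
Qed.

(** * Affine changes of variable *)

Section affine_maps.
Variables (R : realType) (n : nat).
Local Notation P := (sorgenfrey_pow R n).

Definition affine (a : R) (b : 'I_n -> R) (t : P) : P :=
  fun i => a * (t i : R) + b i.

(** As [a > 0], corners of side [d] pull back to corners of side [d / a]. *)
Lemma affine_continuous a b : 0 < a -> continuous (affine a b).
Proof.
move=> a0 t A /nbhs_corner[d d0 dA].
suff : nbhs t (affine a b @^-1` A) by [].
apply/nbhs_corner; exists (d / a); first by rewrite divr_gt0.
move=> s ts; apply: dA => i; have /andP[ti si] := ts i.
rewrite /affine lerD2r ler_pM2l // ti /= addrAC ltrD2r.
by move: si; rewrite -(ltr_pM2l a0) mulrDr mulrCA divff ?gt_eqF // mulr1.
Qed.

Lemma box_ideal_affine a b A : 0 < a ->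
  box_ideal R n A -> box_ideal R n (affine a b @^-1` A).
Proof.
move=> a0 [k Ak]; exists (Num.truncn ((k%:R + \sum_i `|b i|) / a)).+1.
move=> t /= /Ak /= kt i; rewrite -ler_norml.
apply: le_trans (ltW (truncnS_gt _)); rewrite ler_pdivlMr // mulrC.
rewrite -[X in X * _]gtr0_norm // -normrM.
have bi : `|b i| <= \sum_i `|b i|.
  by rewrite (bigD1 i) //= lerDl sumr_ge0.
have kti : `|a * (t i : R) + b i| <= k%:R by rewrite ler_norml; exact: kt.
rewrite -[X in `|X| <= _](addrK (b i)).
by apply: le_trans (ler_normB _ _) _; rewrite lerD.
Qed.

Lemma affineK a b : a != 0 ->
  cancel (affine a b) (affine a^-1 (fun i => - b i / a)).
Proof.
by move=> a0 t; apply/funext => i; rewrite /affine; field.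
Qed.

Lemma affineVK a b : a != 0 ->
  cancel (affine a^-1 (fun i => - b i / a)) (affine a b).
Proof.
by move=> a0 t; apply/funext => i; rewrite /affine; field.
Qed.

End affine_maps.

(** * Averages of continuous sign functions *)

Lemma sum_threshold (R : realType) (N K : nat) : (K <= N)%N ->
  \sum_(i < N) (if (i < K)%N then 1 else -1) = K%:R *+ 2 - N%:R :> R.
Proof.
move=> KN.
rewrite (eq_bigr (fun i : 'I_N => (if (i < K)%N then 1 else 0) *+ 2 - 1 : R));
  last first.
  by move=> i _; case: ifP => _; ring.
rewrite sumrB sumr_const card_ord; congr (_ - _).
by rewrite sumrMnl -big_mkcond (big_ord_narrow KN) sumr_const card_ord.
Qed.

(** For a locally constant [g] close to [y], having [h = N * (g + 1) / 2] signs equal to 1 would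
    give the average [g]; rounding [h] down costs at most [2 / N]. *)
Lemma sign_average (R : realType) (n N : nat) (y : sorgenfrey_pow R n -> R)
    (e : R) : continuous y -> (forall t, `|y t| <= 1) -> 0 < e -> (0 < N)%N ->
  exists sg : 'I_N -> sorgenfrey_pow R n -> R,
    [/\ forall i, continuous (sg i), forall i t, `|sg i t| = 1 &
        forall t, `|y t - N%:R^-1 * \sum_i sg i t| <= e + 2 / N%:R].
Proof.
move=> cy y1 e0 N0; have [K [k [lk yk]]] := clopen_partition cy e0.
have N0' : (0 : R) < N%:R by rewrite ltr0n.
(* The value of [y] at a point chosen in the class of [t], so that [g t] depends on [k t] only. *)
pose g t := y (get [set s | k s = k t]).
have yg t : `|y t - g t| <= e.
  by apply: yk; have /getPex/= -> : exists s, [set s | k s = k t] s by exists t.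
pose h t := (g t + 1) / 2 * N%:R.
have h0 t : 0 <= h t.
  have := y1 (get [set s | k s = k t]); rewrite ler_norml -/(g t).
  move=> /andP[g0 _].
  by rewrite mulr_ge0 ?divr_ge0 ?ler0n // -lerBlDr sub0r.
have hN t : h t <= N%:R.
  have := y1 (get [set s | k s = k t]); rewrite ler_norml -/(g t).
  move=> /andP[_ g1].
  rewrite -[leRHS]mul1r ler_pM2r // ler_pdivrMr //; lra.
pose sg (i : 'I_N) t : R := if (i < Num.truncn (h t))%N then 1 else -1.
exists sg; split.
- move=> i t; apply: (near_cst_continuous (sg i t)).
  by apply: filterS (lk t) => s st; rewrite /sg /h /g st.
- by move=> i t; rewrite /sg; case: ifP; rewrite ?normrN normr1.
move=> t; rewrite sum_threshold; last first.
  by rewrite -(ler_nat R) (le_trans _ (hN t)) // truncn_le.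
have gE : g t = h t / N%:R *+ 2 - 1.
  by rewrite /h mulfK ?gt_eqF //; field.
have /andP[K1 K2] := truncn_itv (h0 t).
set q := Num.truncn _ in K1 K2 *.
rewrite -(subrK (g t) (y t)) -addrA; apply: le_trans (ler_normD _ _) _.
rewrite lerD // (_ : _ - _ = (h t - q%:R) * 2 / N%:R); last first.
  by rewrite gE; field; rewrite gt_eqF.
rewrite ger0_norm; last by rewrite !mulr_ge0 ?subr_ge0 ?invr_ge0 ?ler0n.
rewrite ler_pM2r ?invr_gt0 //.
by rewrite -[leRHS]mul1r ler_pM2r // lerBlDl -(natrD _ _ 1) addn1 ltW.
Qed.

(** * Approximation of [y] by averages of isometric images of [x] *)

Theorem theorem2p1 (R : realType) (n : nat) :
  uniformly_convex_transitive (CB0 R (box_ideal R n)).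
Proof.
move=> e e0; pose d := e / 5; have d0 : 0 < d by rewrite divr_gt0.
(* [N] depends on [e] only, as uniformity requires. *)
pose N := (Num.truncn (2 / d)).+1; have N0 : (0 : R) < N%:R by rewrite ltr0n.
have Nd : 2 / N%:R <= d.
  by rewrite ler_pdivrMr // mulrC -ler_pdivrMr //; apply/ltW/truncnS_gt.
exists N => x y x1 y1.
have le1 (f : CB0 R (box_ideal R n)) : unit_sphere f -> forall t, `|f t| <= 1.
  by move=> f1 t; rewrite -[leRHS]f1; exact: le_sup_norm.
have [t0 xt0] : exists t0, 1 - d < `|x t0|.
  apply: contrapT => nx.
  suff : `|x| < 1 by rewrite x1 ltxx.
  (* The maximum with 0 is there because [1 - d] may be negative. *)
  apply: (@le_lt_trans _ _ (Num.max 0 (1 - d))).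
    apply: sup_norm_le => [|t]; first by rewrite le_max lexx.
    rewrite le_max; apply/orP; right; rewrite leNgt; apply/negP => xt.
    by apply: nx; exists t.
  by rewrite gt_max ltr01 ltrBlDl ltrDr.
pose s : R := if 0 <= x t0 then 1 else -1.
have s1 : `|s| = 1 by rewrite /s; case: ifP; rewrite ?normrN normr1.
have sx0 : s * x t0 = `|x t0|.
  rewrite /s; case: ifPn => [x0|]; first by rewrite mul1r ger0_norm.
  by rewrite -ltNge => x0; rewrite mulN1r ltr0_norm.
have r0 : 0 < `|x t0| - (1 - d) by rewrite subr_gt0.
have /cvgrPdist_le /(_ _ r0) /nbhs_corner[c c0 xc] := @CB_continuous _ _ x t0.
have xs t : corner t0 c t -> `|1 - s * x t| <= d.
  have sE : `|s * (x t0 - x t)| = `|x t0 - x t| by rewrite normrM s1 mul1r.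
  move=> /xc /=; rewrite -sE mulrBr sx0 => xt.
  have sx1 : s * x t <= 1.
    by apply: le_trans (ler_norm _) _; rewrite normrM s1 mul1r le1.
  rewrite ger0_norm ?subr_ge0 //.
  by move: xt; rewrite ler_norml => /andP[_ ?]; lra.
have /cb0P /(_ d d0) [k yk] := CB0_valP y.
(* [phi] maps [[-k, k]^n] onto [t0 + [0, 2 * a * k]^n]; the [+ 1] ensures [2 * a * k < c], also for
   [k = 0]. *)
pose a := c / (k%:R *+ 2 + 1); have k2 : 0 < k%:R *+ 2 + 1 :> R.
  by rewrite ltr_wpDl // mulrn_wge0.
have a0 : 0 < a by rewrite divr_gt0.
pose b i := (t0 i : R) + a * k%:R.
pose phi := affine a b.
have aN0 : a != 0 by rewrite gt_eqF.
have aV0 : 0 < a^-1 by rewrite invr_gt0.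
have phi_box t : d <= `|y t| -> corner t0 c (phi t).
  move=> /yk /= kt i; have /andP[kt1 kt2] := kt i.
  rewrite /phi /affine /b addrCA -mulrDr lerDl ltrD2l.
  rewrite mulr_ge0 ?(ltW a0) //=; last by rewrite -lerBlDr sub0r.
  rewrite /a mulrAC ltr_pdivrMr // ltr_pM2l //; lra.
have [sg [csg sg1 sgy]] := @sign_average R n N y d (@CB_continuous _ _ y)
  (le1 _ y1) d0 (ltn0Sn _).
have /choice[L LP] (i : 'I_N) : exists L :
    {linear CB0 R (box_ideal R n) -> CB0 R (box_ideal R n)},
    isometric_automorphism L /\ forall f t, L f t = s * sg i t * f (phi t).
  have [|||||||t|L] := @weighted_composition R _ (box_ideal R n) phi
    (affine a^-1 (fun i => - b i / a)) (fun t => s * sg i t); last by exists L.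
  - exact: affineK.
  - exact: affineVK.
  - exact: affine_continuous.
  - exact: affine_continuous.
  - by move=> A; exact: box_ideal_affine.
  - by move=> A; exact: box_ideal_affine.
  - move=> t; apply: (@continuousM _ _ (fun=> s) (sg i)); last exact: csg.
    exact: cst_continuous.
  - by rewrite normrM s1 sg1 mulr1.
apply: (@edist_inf_le _ _ _ _ (\sum_i N%:R^-1 *: L i x)).
  exists L, (fun=> N%:R^-1); split => // [i|i|].
  - by have [] := LP i.
  - by rewrite invr_ge0 ler0n invf_le1 // ler1n.
  - by rewrite sumr_const card_ord -[LHS]mulr_natl mulfV // gt_eqF.
apply: sup_norm_le => [|t]; first exact: ltW.
have sumE : (\sum_i N%:R^-1 *: L i x) t =
    (N%:R^-1 * \sum_i sg i t) * (s * x (phi t)).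
  rewrite (big_morph (fun f : CB0 R (box_ideal R n) => f t)
    (id1 := 0) (op1 := +%R)) //.
  rewrite mulr_sumr mulr_suml; apply: eq_bigr => i _.
  rewrite [LHS](_ : _ = N%:R^-1 * L i x t) // (LP i).2; ring.
rewrite [X in `|X|](_ : _ = y t - (\sum_i N%:R^-1 *: L i x) t) // sumE.
move: (sgy t); move: (N%:R^-1 * _) => m ym.
have {ym}ym : `|y t - m| <= d + d by apply: le_trans ym _; rewrite lerD2l.
have yt1 := le1 _ y1 t; have eE : e = 5 * d by rewrite /d; field.
have [ydt|ydt] := leP d `|y t|.
  (* Both [y t - m] and [1 - s * x (phi t)] are small here; the total is at most [3 * d]. *)
  rewrite (_ : _ - _ = (y t - m) * (s * x (phi t)) +
    y t * (1 - s * x (phi t))); last by ring.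
  apply: le_trans (ler_normD _ _) _; rewrite !normrM s1 mul1r.
  have := xs _ (phi_box _ ydt); have := le1 _ x1 (phi t) => xp xsp.
  have h1 : `|y t - m| * `|x (phi t)| <= (d + d) * 1 by apply: ler_pM.
  have h2 : `|y t| * `|1 - s * x (phi t)| <= 1 * d by apply: ler_pM.
  lra.
(* Here nothing is known of [x (phi t)] beyond [|x| <= 1], but [m] is small along with [y t]; the
   total is at most [4 * d]. *)
have mt : `|m| <= d + d + d.
  rewrite -(subKr (y t) m); apply: le_trans (ler_normB _ _) _.
  by rewrite addrC lerD // ltW.
apply: le_trans (ler_normB _ _) _; rewrite !normrM s1 mul1r.
have h1 : `|m| * `|x (phi t)| <= (d + d + d) * 1.
  by apply: ler_pM => //; exact: le1.
lra.
Qed.
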